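(* Let $p$ be an odd prime, $m,s$ positive integers, $R=\mathbb F_{p^m}+u\mathbb F_{p^m}$ with $u^2=0$, let $\sigma$ be a ring automorphism of $R$, let $\gamma\in\mathbb F_{p^m}^\ast$, and let $\gamma_0\in\mathbb F_{p^m}$ be the element with $\gamma_0^{p^s}=\gamma^{-1}$. Let $C=\langle u(\gamma_0x-1)^i\rangle\subseteq R[x]/\langle x^{p^s}-\gamma\rangle$ be a $\gamma$-constacyclic code of length $p^s$ over $R$, where $0\le i\le p^s-1$. Then: (1) $C$ is $\sigma$-self-orthogonal. (2) $C$ is $\sigma$-self-dual if and only if $i=0$, i.e. $C=\langle u\rangle$.
   Context: A $\gamma$-constacyclic code of length $n$ over $R$ is an $R$-submodule of $R^n$ stable under $(x_0,\dots,x_{n-1})\mapsto(\gamma x_{n-1},x_0,\dots,x_{n-2})$; it is identified with an ideal of $R[x]/\langle x^n-\gamma\rangle$ via $(c_0,\dots,c_{n-1})\mapsto c_0+c_1x+\cdots+c_{n-1}x^{n-1}$. The $\sigma$-dual of $C\subseteq R^n$ is $C^{\perp_\sigma}=\{\mathbf x\in R^n:\sum_{i=0}^{n-1}c_i\sigma(x_i)=0\text{ for all }\mathbf c\in C\}$; $C$ is $\sigma$-self-orthogonal if $C\subseteq C^{\perp_\sigma}$ and $\sigma$-self-dual if $C=C^{\perp_\sigma}$ (as subsets of $R^n$). *)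

(* Defs.v *)
From HB Require Import structures.
From mathcomp Require Import all_boot all_algebra.

Set Implicit Arguments.
Unset Strict Implicit.
Unset Printing Implicit Defensive.

Import GRing.Theory.
Local Open Scope ring_scope.

(* Makes a quotient of a finite commutative ring a finComNzRingType; the library
   only equips it with the finType and comNzRingType structures. *)
HB.instance Definition _ (R : finComNzRingType) (h : {poly R}) :=
  Finite.on {poly %/ h}.

(* The chain ring F[u]/<u^2> = F + uF; 'qX is the class u, and
   qpolyC embeds F. *)
Notation chain_ring F := {poly %/ ('X^2 : {poly F})}.

Definition cr_u (F : finFieldType) : chain_ring F := 'qX.

Definition cr_const (F : finFieldType) (a : F) : chain_ring F :=
  qpolyC 'X^2 a.

(* The library's {poly %/ h} is the quotient by h only for monic h of positive
   degree, so this is R[x]/<x^n - gamma> for n > 0 only. *)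
Notation ambient R n gamma := {poly %/ ('X^n - gamma%:P : {poly R})}.

Section Codes.

Variables (R : finComNzRingType) (n : nat).

Implicit Types (gamma : R) (C : {set 'rV[R]_n}) (sigma : R -> R).

(* (x_0, ..., x_(n-1)) |-> (gamma x_(n-1), x_0, ..., x_(n-2)); ord_pred is the
   predecessor modulo n. *)
Definition constashift gamma (x : 'rV[R]_n) : 'rV[R]_n :=
  \row_j (if j == 0%N :> nat then gamma * x 0 (ord_pred j) else x 0 (ord_pred j)).

Definition constacyclic gamma C : Prop :=
  submod_closed (mem C) /\ {in C, forall x, constashift gamma x \in C}.

Definition word_class gamma (x : 'rV[R]_n) : ambient R n gamma :=
  in_qpoly _ (rVpoly x).

Definition sigma_dual sigma C : {set 'rV[R]_n} :=
  [set x : 'rV[R]_n | [forall c : 'rV[R]_n in C, \sum_i c 0 i * sigma (x 0 i) == 0]].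

Definition sigma_self_orthogonal sigma C : Prop :=
  C \subset sigma_dual sigma C.

Definition sigma_self_dual sigma C : Prop := C = sigma_dual sigma C.

End Codes.

Definition principal_ideal (S : finComNzRingType) (g : S) : {set S} :=
  [set q * g | q : S].

(* Main.v *)
(** Every codeword of C has its entries in uR, since C is generated by a
multiple of u; as u is nilpotent, sigma maps uR into the elements annihilated
by u, which is self-orthogonality.  The annihilator of u is uR itself, so for
i = 0, where C is the set of all words over uR, C is self-dual.  Conversely the
word (u, 0, ..., 0) always lies in the sigma-dual; if it lies in C then u is a
multiple of u g^i with g = gamma_0 x - 1.  As g^(p^s) = 0 while
u g^(p^s - 1) <> 0, multiplying by g^(p^s - 1) forces i = 0. *)

Require Import Defs.
From mathcomp Require Import all_boot all_algebra all_field.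

Set Implicit Arguments.
Unset Strict Implicit.
Unset Printing Implicit Defensive.

Import GRing.Theory.
Local Open Scope ring_scope.

Lemma mk_monicX2 (R : nzRingType) : mk_monic ('X^2 : {poly R}) = 'X^2.
Proof. by rewrite /mk_monic size_polyXn monicXn. Qed.

Lemma in_qpolyK (R : nzRingType) (h : {poly R}) : cancel val (in_qpoly h).
Proof. by move=> z; apply: val_inj; rewrite [LHS]in_qpoly_small ?size_mk_monic. Qed.

Lemma in_qpolyX2_eq0 (K : fieldType) (q : {poly K}) :
  in_qpoly 'X^2 q = 0 -> 'X^2 %| q.
Proof.
move=> /(congr1 val) /=; rewrite mk_monicX2 Pdiv.Field.dvdpE.
by move=> ?; apply/Pdiv.Ring.rmodp_eq0P.
Qed.

Section ChainRing.

Variable F : finFieldType.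
Implicit Types (z : chain_ring F) (a : F).

Lemma cr_constE a : cr_const a = in_qpoly 'X^2 a%:P.
Proof.
apply: val_inj; rewrite [RHS]in_qpoly_small // mk_monicX2 size_polyXn.
exact: leq_ltn_trans (size_polyC_leq1 a) _.
Qed.

Lemma cr_const1 : cr_const 1 = 1 :> chain_ring F.
Proof. by rewrite cr_constE in_qpoly1. Qed.

Lemma cr_constM a b : cr_const (a * b) = cr_const a * cr_const b.
Proof. by rewrite !cr_constE polyCM in_qpolyM. Qed.

Lemma cr_constX a k : cr_const (a ^+ k) = cr_const a ^+ k.
Proof. by rewrite !cr_constE !rmorphXn. Qed.

Lemma pchar_chain_ring p : p \in [pchar F] -> p \in [pchar chain_ring F].
Proof.
move=> pcharFp; apply: (rmorph_pchar (in_qpoly 'X^2)).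
exact: (rmorph_pchar (@polyC F)).
Qed.

Lemma cr_u_neq0 : cr_u F != 0.
Proof.
apply/eqP => /(congr1 val); rewrite [val (cr_u F)]in_qpoly_small.
  by move/eqP; rewrite polyX_eq0.
by rewrite mk_monicX2 size_polyXn size_polyX.
Qed.

Lemma cr_u_sqr : cr_u F * cr_u F = 0.
Proof.
rewrite /cr_u /qpolyX -in_qpolyM -expr2; apply: val_inj.
by rewrite /= mk_monicX2 Pdiv.RingMonic.rmodpp ?monicXn.
Qed.

(** Lifted to [{poly F}] the hypothesis reads ['X^2 %| 'X * z], and one factor ['X] cancels. *)
Lemma cr_u_ann z : cr_u F * z = 0 -> exists y, z = cr_u F * y.
Proof.
rewrite -[z]in_qpolyK -in_qpolyM => /in_qpolyX2_eq0.
rewrite [X in X %| _]expr2 dvdp_mul2l ?polyX_eq0 // => /dvdpP [q ->].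
by exists (in_qpoly 'X^2 q); rewrite mulrC in_qpolyM.
Qed.

(** On representatives ['X^2] divides [z ^+ 2], so ['X] divides [z]. This gives control of [sigma]
    without its explicit form, as ring morphisms preserve square-zero elements. *)
Lemma cr_u_mul_sqr0 z : z * z = 0 -> cr_u F * z = 0.
Proof.
rewrite -[z]in_qpolyK -in_qpolyM => /in_qpolyX2_eq0.
rewrite -[X in _ %| X]expr2 dvdp_pexp2r // => /dvdpP [q ->].
by rewrite in_qpolyM mulrCA cr_u_sqr mulr0.
Qed.

End ChainRing.

Section WordClass.

Variables (R : finComNzRingType) (n : nat) (gamma : R).
Hypothesis n_gt0 : (0 < n)%N.
Implicit Types (x y : 'rV[R]_n) (a b : ambient R n gamma).

Definition class_word a : 'rV[R]_n := poly_rV (val a).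

Lemma mk_monic_ambient : mk_monic ('X^n - gamma%:P) = 'X^n - gamma%:P.
Proof. by rewrite /mk_monic size_XnsubC // monicXnsubC // ltnS n_gt0. Qed.

Lemma size_ambient a : (size (val a) <= n)%N.
Proof.
by have := size_mk_monic a; rewrite [X in (_ < size (polyseq X))%N]mk_monic_ambient size_XnsubC.
Qed.

Lemma in_ambient_small (q : {poly R}) :
  (size q <= n)%N -> val (in_qpoly ('X^n - gamma%:P) q) = q.
Proof.
by move=> le_q_n; rewrite [LHS]in_qpoly_small // mk_monic_ambient size_XnsubC.
Qed.

Lemma word_classK : cancel (word_class gamma) class_word.
Proof.
by move=> x; rewrite /class_word /word_class in_ambient_small ?size_poly ?rVpolyK.
Qed.

Lemma class_wordK : cancel class_word (word_class gamma).
Proof.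
move=> a; rewrite /class_word /word_class poly_rV_K ?size_ambient //.
exact: in_qpolyK.
Qed.

Lemma word_classZ r x : word_class gamma (r *: x) = r *: word_class gamma x.
Proof. by rewrite /word_class linearZ in_qpolyZ. Qed.

Lemma ambientXn : ('qX : ambient R n gamma) ^+ n = gamma%:A.
Proof.
have: in_qpoly ('X^n - gamma%:P) ('X^n - gamma%:P) = 0.
  by apply: val_inj; rewrite /= mk_monic_ambient Pdiv.RingMonic.rmodpp ?monicXnsubC.
rewrite linearB /= rmorphXn -alg_polyC in_qpolyZ in_qpoly1.
by move/eqP; rewrite subr_eq0 => /eqP.
Qed.

Lemma mem_code (C : {set 'rV[R]_n}) g x :
    word_class gamma @: C = principal_ideal g ->
  (x \in C) = (word_class gamma x \in principal_ideal g).
Proof. by move <-; rewrite (mem_imset _ _ (can_inj word_classK)). Qed.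

(** The polynomial [r *: (c *: 'X - 1) ^+ k] has degree below [n], so it is its own reduced
    representative; its constant term is [r] up to sign. *)
Lemma scale_linear_exp_neq0 (r c : R) k : r != 0 -> (k < n)%N ->
  r *: (c *: 'qX - 1 : ambient R n gamma) ^+ k != 0.
Proof.
move=> r_neq0 lt_k_n; set q : {poly R} := c *: 'X - 1.
have le_q : (size q <= 2)%N.
  rewrite (leq_trans (size_polyD _ _)) // size_polyN size_poly1 geq_max.
  by rewrite (leq_trans (size_scale_leq _ _)) ?size_polyX.
have -> : r *: (c *: 'qX - 1 : ambient R n gamma) ^+ k =
    in_qpoly ('X^n - gamma%:P) (r *: q ^+ k).
  by rewrite in_qpolyZ rmorphXn /= /q linearB /= in_qpolyZ in_qpoly1.
apply/eqP => /(congr1 val); rewrite in_ambient_small => [/(congr1 (horner^~ 0))|].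
  (* The value at 0 is [r * (-1) ^+ k]; a second factor [(-1) ^+ k] recovers [r]. *)
  rewrite hornerZ horner_exp !hornerE => /(congr1 ( *%R^~ ((-1) ^+ k))).
  by rewrite -mulrA -exprMn mulrNN mul1r expr1n mulr1 mul0r; apply/eqP.
apply: leq_trans (size_scale_leq _ _) _.
apply: leq_trans (size_poly_exp_leq _ _) (leq_ltn_trans _ lt_k_n).
by rewrite -[leqRHS]mul1n leq_mul2r -subn1 leq_subLR le_q orbT.
Qed.

End WordClass.

(** If [i] were positive, multiplying the last equation by [g ^+ n] would produce a factor
    [g ^+ n.+1] and kill [w * g ^+ n]. *)
Lemma nilpotent_generator_exp0 (S : comNzRingType) (w g q : S) (n i : nat) :
    g ^+ n.+1 = 0 -> w * g ^+ n != 0 -> w = q * (w * g ^+ i) -> i = 0%N.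
Proof.
case: i => // i gn0 /eqP wgn Ew; case: wgn.
have -> : w * g ^+ n = q * w * g ^+ i * g ^+ n.+1.
  by rewrite {1}Ew exprSr exprS !mulrA.
by rewrite gn0 mulr0.
Qed.

Theorem theorem4p4
    (p m s : nat) (p_prime : prime p) (p_odd : odd p)
    (m_gt0 : (0 < m)%N) (s_gt0 : (0 < s)%N)
    (F : finFieldType) (cardF : #|F| = (p ^ m)%N)
    (sigma : {rmorphism chain_ring F -> chain_ring F})
    (sigma_bij : bijective sigma)
    (gamma : F) (gamma_neq0 : gamma != 0)
    (gamma0 : F) (gamma0E : gamma0 ^+ (p ^ s) = gamma^-1)
    (i : nat) (le_i : (i <= p ^ s - 1)%N)
    (C : {set 'rV[chain_ring F]_(p ^ s)})
    (C_constacyclic : constacyclic (cr_const gamma) C)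
    (C_gen : word_class (cr_const gamma) @: C =
       principal_ideal
         (cr_u F *: (cr_const gamma0 *: 'qX - 1) ^+ i
            : ambient (chain_ring F) (p ^ s) (cr_const gamma))) :
  sigma_self_orthogonal sigma C /\
  (sigma_self_dual sigma C <-> i = 0%N) /\
  (i = 0%N <->
     word_class (cr_const gamma) @: C =
       principal_ideal
         ((cr_u F)%:A : ambient (chain_ring F) (p ^ s) (cr_const gamma))).
Proof.
have n_gt0 : (0 < p ^ s)%N by rewrite expn_gt0 prime_gt0.
set u := cr_u F in C_gen *; set g := cr_const gamma0 *: 'qX - 1 in C_gen.
have pcharA : p \in [pchar ambient (chain_ring F) (p ^ s) (cr_const gamma)].
  apply: (rmorph_pchar (in_qpoly _)); apply: (rmorph_pchar (@polyC _)).
  exact/pchar_chain_ring/(card_finPcharP cardF p_prime).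
have gn0 : g ^+ (p ^ s) = 0.
  have pnat_n : [pchar ambient (chain_ring F) (p ^ s) (cr_const gamma)].-nat (p ^ s)%N.
    by rewrite (eq_pnat _ (pcharf_eq pcharA)) pnatX pnat_id.
  (* In characteristic [p] the power is additive: it equals [gamma0 ^+ (p ^ s) * gamma - 1], which
     is 0. *)
  rewrite exprDn_pchar // exprNn_pchar // expr1n exprZn ambientXn // scalerA.
  by rewrite -cr_constX -cr_constM gamma0E mulVf // cr_const1 scale1r subrr.
(* Both equivalences get [i = 0] from the class of [u] lying in the ideal. *)
have i0 : u%:A \in principal_ideal (u *: g ^+ i) -> i = 0%N.
  move/imsetP => [q _ Eu].
  apply: (@nilpotent_generator_exp0 _ u%:A g q (p ^ s).-1 i).
  - by rewrite prednK.
  - by rewrite mulr_algl scale_linear_exp_neq0 ?cr_u_neq0 // prednK.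
  - by rewrite mulr_algl.
have C_u c : c \in C -> exists y, c = u *: y.
  rewrite (mem_code n_gt0 _ C_gen) => /imsetP [q _ Ec].
  exists (class_word (q * g ^+ i)); rewrite -[c](word_classK (cr_const gamma) n_gt0).
  by rewrite Ec -scalerAr /class_word linearZ.
have sigma_u a : u * sigma (u * a) = 0.
  apply: cr_u_mul_sqr0.
  by rewrite -rmorphM mulrACA cr_u_sqr mul0r rmorph0.
have dualE (y c : 'rV_(p ^ s)) : c \in C -> \sum_j c 0 j * sigma ((u *: y) 0 j) = 0.
  move=> /C_u [z ->]; apply: big1 => j _.
  by rewrite !mxE mulrAC sigma_u mul0r.
have u_dual (y : 'rV_(p ^ s)) : u *: y \in sigma_dual sigma C.
  by rewrite inE; apply/forall_inP => c /dualE ->.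
have self_orth : C \subset sigma_dual sigma C.
  by apply/subsetP => c /C_u [y ->].
(* The word here is (u, 0, ..., 0). *)
have Wu1 : word_class (cr_const gamma) (u *: @class_word _ (p ^ s) (cr_const gamma) 1) = u%:A.
  by rewrite word_classZ class_wordK.
split=> //; split; split.
- move=> selfC; apply: i0.
  by rewrite -Wu1 -(mem_code n_gt0 _ C_gen) selfC.
- move=> i_0; rewrite i_0 expr0 in C_gen.
  have u_C (y : 'rV_(p ^ s)) : u *: y \in C.
    rewrite (mem_code n_gt0 _ C_gen); apply/imsetP.
    by exists (word_class (cr_const gamma) y); rewrite // word_classZ mulr_algr.
  apply/eqP; rewrite eqEsubset self_orth; apply/subsetP => x; rewrite inE.
  move=> /forall_inP dual_x.
  (* Pairing [x] with the codeword having [u] in position [j] and 0 elsewhere gives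
     [u * sigma (x 0 j) = 0]. So [sigma (x 0 j)] is a multiple of [u] and squares to 0; by
     injectivity so does [x 0 j], which is then a multiple of [u]. *)
  have /fin_all_exists [y Ey] j : exists y, x 0 j = u * y.
    apply/cr_u_ann/cr_u_mul_sqr0/(bij_inj sigma_bij); rewrite rmorphM rmorph0.
    have /eqP := dual_x _ (u_C (delta_mx 0 j)).
    rewrite (bigD1 j) //= big1 => [|k neq_kj]; last first.
      by rewrite !mxE (negPf neq_kj) mulr0 mul0r.
    rewrite addr0 !mxE !eqxx mulr1 => /cr_u_ann [z ->].
    by rewrite mulrACA cr_u_sqr mul0r.
  suff -> : x = u *: \row_j y j by [].
  by apply/rowP => j; rewrite !mxE Ey.
- by move=> i_0; rewrite C_gen i_0 expr0.
- move=> C_u1; apply: i0; rewrite -C_gen C_u1.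
  by apply/imsetP; exists 1; rewrite ?mul1r.
Qed.
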